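(* Let $\mathcal{C}$ be a $1$-category with finite products, and let $G$ be a comonad on $\mathcal{C}$ which preserves these. Then: \begin{enumerate} \item The forgetful functor $\mathrm{CoAlg}_G\to\mathcal{C}$ creates finite products. \item The resulting forgetful functor $\mathrm{Ab}(\mathrm{CoAlg}_G)\to\mathrm{Ab}(\mathcal{C})$ is comonadic. \item The commutative diagram of forgetful functors \[\begin{array}{ccc}\mathrm{Ab}(\mathrm{CoAlg}_G)&\to&\mathrm{Ab}(\mathcal{C})\\ {\scriptstyle U'}\downarrow&&\downarrow{\scriptstyle U}\\ \mathrm{CoAlg}_G&\to&\mathcal{C}\end{array}\] is Cartesian whenever $U$ is fully faithful. \item The natural transformation $U'\circ G'\to G\circ U$ of functors $\mathrm{Ab}(\mathcal{C})\to\mathrm{CoAlg}_G$ is an isomorphism, where $G'\colon\mathrm{Ab}(\mathcal{C})\to\mathrm{Ab}(\mathrm{CoAlg}_G)$ and $G\colon\mathcal{C}\to\mathrm{CoAlg}_G$ are the right adjoints (cofree functors) to the horizontal forgetful functors. \item If $U$ admits a left adjoint $D$, then $D$ lifts to a left adjoint $D'\colon\mathrm{CoAlg}_G\to\mathrm{Ab}(\mathrm{CoAlg}_G)$ of $U'$ making the diagram in (3) distributive. \end{enumerate}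
   Context: $\mathrm{CoAlg}_G$ is the category of coalgebras for the comonad $G$, and $\mathrm{Ab}(-)$ is the category of abelian group objects. A distributive square is a commutative square of functors $V'\colon\mathcal{D}'\to\mathcal{D}$, $U'\colon\mathcal{D}'\to\mathcal{C}'$, $V\colon\mathcal{C}'\to\mathcal{C}$, $U\colon\mathcal{D}\to\mathcal{C}$ ($UV'\cong VU'$) such that $U'$, $U$ have left adjoints $T'\dashv U'$, $T\dashv U$, and the mate $TV\to V'T'$ is an isomorphism. In (5), $\mathcal{D}'=\mathrm{Ab}(\mathrm{CoAlg}_G)$, $\mathcal{D}=\mathrm{Ab}(\mathcal{C})$, $\mathcal{C}'=\mathrm{CoAlg}_G$, $T'=D'$, $T=D$. *)

(* Defs.v *)
From mathcomp Require Import ssreflect ssrfun ssrbool eqtype ssrnat fintype.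
From Stdlib Require Import ProofIrrelevance IndefiniteDescription.

Set Implicit Arguments.
Unset Strict Implicit.
Unset Printing Implicit Defensive.

Declare Scope cat_scope.
Delimit Scope cat_scope with cat.
Local Open Scope cat_scope.

Record Category := {
  Ob :> Type;
  Hom : Ob -> Ob -> Type;
  idm : forall X, Hom X X;
  cmp : forall X Y Z, Hom Y Z -> Hom X Y -> Hom X Z;
  cmpA : forall X Y Z W (h : Hom Z W) (g : Hom Y Z) (f : Hom X Y),
    cmp h (cmp g f) = cmp (cmp h g) f;
  cmp1m : forall X Y (f : Hom X Y), cmp (idm Y) f = f;
  cmpm1 : forall X Y (f : Hom X Y), cmp f (idm X) = f }.

Arguments Hom {c} X Y.
Arguments idm {c} X.
Arguments cmp {c X Y Z} g f.
Notation "g ∘ f" := (cmp g f) (at level 40, left associativity) : cat_scope.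

Definition IsIso (C : Category) (X Y : C) (f : Hom X Y) : Prop :=
  exists g : Hom Y X, g ∘ f = idm X /\ f ∘ g = idm Y.

Record Functor (C D : Category) := {
  fob :> C -> D;
  fmap : forall X Y, Hom X Y -> Hom (fob X) (fob Y);
  fmap1 : forall X, fmap (idm X) = idm (fob X);
  fmapM : forall X Y Z (g : Hom Y Z) (f : Hom X Y),
    fmap (g ∘ f) = fmap g ∘ fmap f }.

Arguments fmap {C D} F {X Y} f : rename.

Definition fid (C : Category) : Functor C C :=
  {| fob := fun X => X; fmap := fun X Y f => f;
     fmap1 := fun X => erefl; fmapM := fun X Y Z g f => erefl |}.

Lemma fcomp_id (C D E : Category) (G : Functor D E) (F : Functor C D) (X : C) :
  fmap G (fmap F (idm X)) = idm (G (F X)).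
Proof. by rewrite !fmap1. Qed.

Lemma fcomp_cmp (C D E : Category) (G : Functor D E) (F : Functor C D)
    (X Y Z : C) (g : Hom Y Z) (f : Hom X Y) :
  fmap G (fmap F (g ∘ f)) = fmap G (fmap F g) ∘ fmap G (fmap F f).
Proof. by rewrite !fmapM. Qed.

Definition fcomp (C D E : Category) (G : Functor D E) (F : Functor C D) :
    Functor C E :=
  {| fob := fun X => G (F X); fmap := fun X Y f => fmap G (fmap F f);
     fmap1 := fcomp_id G F; fmapM := @fcomp_cmp C D E G F |}.
Notation "G ∙ F" := (fcomp G F) (at level 40, left associativity) : cat_scope.

Record NatTrans (C D : Category) (F G : Functor C D) := {
  nt :> forall X, Hom (F X) (G X);
  ntN : forall X Y (f : Hom X Y), nt Y ∘ fmap F f = fmap G f ∘ nt X }.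

Definition IsNatIso (C D : Category) (F G : Functor C D)
  (a : NatTrans F G) : Prop := forall X, IsIso (a X).

Definition FullyFaithful (C D : Category) (F : Functor C D) : Prop :=
  forall X Y (g : Hom (F X) (F Y)), exists! f : Hom X Y, fmap F f = g.

Definition IsEquivalence (C D : Category) (F : Functor C D) : Prop :=
  exists (K : Functor D C) (e : NatTrans (fid C) (K ∙ F))
         (d : NatTrans (F ∙ K) (fid D)), IsNatIso e /\ IsNatIso d.

Record Adjunction (C D : Category) (L : Functor C D) (R : Functor D C) := {
  unit : NatTrans (fid C) (R ∙ L);
  counit : NatTrans (L ∙ R) (fid D);
  triangleL : forall X, counit (L X) ∘ fmap L (unit X) = idm (L X);
  triangleR : forall Y, fmap R (counit Y) ∘ unit (R Y) = idm (R Y) }.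

Record Cone (C : Category) (I : Type) (X : I -> C) := {
  apex :> C;
  proj : forall i, Hom apex (X i) }.
Arguments proj {C I X} c i.

Definition IsProduct (C : Category) (I : Type) (X : I -> C) (c : Cone X) :
    Prop :=
  forall (Q : C) (f : forall i, Hom Q (X i)),
    exists! h : Hom Q c, forall i, proj c i ∘ h = f i.

Definition HasFiniteProducts (C : Category) : Prop :=
  forall (I : finType) (X : I -> C), exists c : Cone X, IsProduct c.

Definition map_cone (C D : Category) (F : Functor C D) (I : Type) (X : I -> C)
    (c : Cone X) : Cone (fun i => F (X i)) :=
  {| apex := F c; proj := fun i => fmap F (proj c i) |}.

Definition PreservesFiniteProducts (C D : Category) (F : Functor C D) : Prop :=
  forall (I : finType) (X : I -> C) (c : Cone X),
    IsProduct c -> IsProduct (map_cone F c).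

(* Creation of limits in Mac Lane's strict sense, for finite discrete diagrams:
   a product cone below has exactly one cone above it, which is a product. *)
Definition CreatesFiniteProducts (C D : Category) (F : Functor C D) : Prop :=
  forall (I : finType) (X : I -> C) (c : Cone (fun i => F (X i))),
    IsProduct c ->
    exists c' : Cone X, [/\ map_cone F c' = c,
      forall c'' : Cone X, map_cone F c'' = c -> c'' = c' & IsProduct c'].

Lemma creates_has (C D : Category) (F : Functor C D) :
  CreatesFiniteProducts F -> HasFiniteProducts D -> HasFiniteProducts C.
Proof.
move=> cr PD I X; have [c /cr [c' [_ _ Hc']]] := PD I (fun i => F (X i)).
by exists c'.
Qed.

Lemma product_uniq (C : Category) (I : Type) (X : I -> C) (c : Cone X)
    (Hc : IsProduct c) (Q : C) (g h : Hom Q c) :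
  (forall i, proj c i ∘ g = proj c i ∘ h) -> g = h.
Proof.
move=> e; have [k [_ u]] := Hc Q (fun i => proj c i ∘ h).
by rewrite -(u g e) -(u h (fun i => erefl)).
Qed.

Lemma creates_preserves (C D : Category) (F : Functor C D) :
  CreatesFiniteProducts F -> HasFiniteProducts D -> PreservesFiniteProducts F.
Proof.
move=> cr PD I X c Hc.
have [b Hb] := PD I (fun i => F (X i)).
have [c' [e _ Hc']] := cr I X b Hb; subst b.
have [u [Hu _]] := Hc' c (proj c).
have [v [Hv _]] := Hc c' (proj c').
have vu : v ∘ u = idm _.
  by apply: (product_uniq Hc) => i; rewrite cmpA Hv Hu cmpm1.
move=> Q f; have [h [Hh hu]] := Hb Q f.
exists (fmap F v ∘ h); split=> [i|k Hk].
  by rewrite /= cmpA -fmapM Hv; exact: Hh.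
have -> : h = fmap F u ∘ k.
  by apply: hu => i; rewrite /= cmpA -fmapM Hu; exact: Hk.
by rewrite cmpA -fmapM vu fmap1 cmp1m.
Qed.

(* Finite products are a property of a category; specific ones are chosen here,
   so that [Ab] below depends on the choice only up to isomorphism. *)
Definition product (C : Category) (PC : HasFiniteProducts C) (I : finType)
    (X : I -> C) : Cone X :=
  proj1_sig (constructive_indefinite_description _ (PC I X)).

Lemma productP (C : Category) (PC : HasFiniteProducts C) (I : finType)
  (X : I -> C) : IsProduct (product PC X).
Proof. by rewrite /product; case: constructive_indefinite_description. Qed.
Arguments productP {C} PC {I} X.

Definition lift (C : Category) (I : Type) (X : I -> C) (c : Cone X)
    (Hc : IsProduct c) (Q : C) (f : forall i, Hom Q (X i)) : Hom Q c :=
  proj1_sig (constructive_indefinite_description _ (Hc Q f)).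

Lemma liftE (C : Category) (I : Type) (X : I -> C) (c : Cone X)
    (Hc : IsProduct c) (Q : C) (f : forall i, Hom Q (X i)) (i : I) :
  proj c i ∘ lift Hc f = f i.
Proof.
by rewrite /lift; case: constructive_indefinite_description => h [Hh _] /=.
Qed.

Definition no_ob (C : Category) (i : void) : C := match i with end.

Definition terminal (C : Category) (PC : HasFiniteProducts C) : C :=
  product PC (@no_ob C).

Definition to_terminal (C : Category) (PC : HasFiniteProducts C) (X : C) :
    Hom X (terminal PC) :=
  lift (productP PC (@no_ob C)) (fun i => match i with end).

Definition power (C : Category) (PC : HasFiniteProducts C) (I : finType)
  (A : C) : Cone (fun _ : I => A) := product PC (fun _ => A).

Definition pair2 (C : Category) (PC : HasFiniteProducts C) (X A : C)
    (f g : Hom X A) : Hom X (power PC bool A) :=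
  lift (productP PC (fun _ : bool => A)) (fun b => if b then f else g).

Definition fst2 (C : Category) (PC : HasFiniteProducts C) (A : C) :
  Hom (power PC bool A) A := proj (power PC bool A) true.

Definition snd2 (C : Category) (PC : HasFiniteProducts C) (A : C) :
  Hom (power PC bool A) A := proj (power PC bool A) false.

(* Associativity is stated on the ternary power of [A] rather than on an
   iterated binary product. *)
Definition proj3 (C : Category) (PC : HasFiniteProducts C) (A : C) (i : 'I_3) :
  Hom (power PC 'I_3 A) A := proj (power PC 'I_3 A) i.

Record AbObj (C : Category) (PC : HasFiniteProducts C) := {
  ab_ob :> C;
  ab_add : Hom (power PC bool ab_ob) ab_ob;
  ab_zero : Hom (terminal PC) ab_ob;
  ab_opp : Hom ab_ob ab_ob;
  ab_addA :
    let p i := proj3 PC ab_ob i in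
    let p0 := p (@Ordinal 3 0 isT) in
    let p1 := p (@Ordinal 3 1 isT) in
    let p2 := p (@Ordinal 3 2 isT) in
    ab_add ∘ pair2 PC (ab_add ∘ pair2 PC p0 p1) p2
      = ab_add ∘ pair2 PC p0 (ab_add ∘ pair2 PC p1 p2);
  ab_addC : ab_add ∘ pair2 PC (snd2 PC ab_ob) (fst2 PC ab_ob) = ab_add;
  ab_add0 :
    ab_add ∘ pair2 PC (ab_zero ∘ to_terminal PC ab_ob) (idm ab_ob)
      = idm ab_ob;
  ab_addN :
    ab_add ∘ pair2 PC ab_opp (idm ab_ob) = ab_zero ∘ to_terminal PC ab_ob }.
Arguments ab_add {C PC} a.
Arguments ab_zero {C PC} a.
Arguments ab_opp {C PC} a.

(* Compatibility with zero and opposites follows from that with addition. *)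
Definition IsAbHom (C : Category) (PC : HasFiniteProducts C) (A B : AbObj PC)
    (f : Hom (ab_ob A) (ab_ob B)) : Prop :=
  f ∘ ab_add A
    = ab_add B ∘ pair2 PC (f ∘ fst2 PC (ab_ob A)) (f ∘ snd2 PC (ab_ob A)).

Definition AbHom (C : Category) (PC : HasFiniteProducts C) (A B : AbObj PC) :=
  {f : Hom (ab_ob A) (ab_ob B) | IsAbHom f}.

Lemma sig_eq (T : Type) (P : T -> Prop) (u v : sig P) :
  proj1_sig u = proj1_sig v -> u = v.
Proof.
case: u v => [x Hx] [y Hy] /= e; subst y; congr exist.
exact: proof_irrelevance.
Qed.

Lemma pair2_uniq (C : Category) (PC : HasFiniteProducts C) (X A : C)
    (h k : Hom X (power PC bool A)) :
  fst2 PC A ∘ h = fst2 PC A ∘ k -> snd2 PC A ∘ h = snd2 PC A ∘ k -> h = k.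
Proof.
by move=> e1 e2; apply: (product_uniq (productP PC _)) => -[].
Qed.

Lemma fst2_pair2 (C : Category) (PC : HasFiniteProducts C) (X A : C)
  (f g : Hom X A) : fst2 PC A ∘ pair2 PC f g = f.
Proof. exact: (liftE (productP PC (fun _ : bool => A)) _ true). Qed.

Lemma snd2_pair2 (C : Category) (PC : HasFiniteProducts C) (X A : C)
  (f g : Hom X A) : snd2 PC A ∘ pair2 PC f g = g.
Proof. exact: (liftE (productP PC (fun _ : bool => A)) _ false). Qed.

Lemma pair2_cmp (C : Category) (PC : HasFiniteProducts C) (X Y A : C)
    (f g : Hom X A) (h : Hom Y X) :
  pair2 PC f g ∘ h = pair2 PC (f ∘ h) (g ∘ h).
Proof.
by apply: pair2_uniq; rewrite cmpA ?fst2_pair2 ?snd2_pair2.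
Qed.

Lemma pair2_eta (C : Category) (PC : HasFiniteProducts C) (A : C) :
  pair2 PC (fst2 PC A) (snd2 PC A) = idm _.
Proof.
by apply: pair2_uniq; rewrite ?fst2_pair2 ?snd2_pair2 cmpm1.
Qed.

Lemma to_terminal_uniq (C : Category) (PC : HasFiniteProducts C) (X : C)
  (f g : Hom X (terminal PC)) : f = g.
Proof. by apply: (product_uniq (productP PC (@no_ob C))) => -[]. Qed.

Lemma ab_idP (C : Category) (PC : HasFiniteProducts C) (A : AbObj PC) :
  IsAbHom (idm A : Hom (ab_ob A) (ab_ob A)).
Proof. by rewrite /IsAbHom !cmp1m pair2_eta cmpm1. Qed.

Lemma ab_cmpP (C : Category) (PC : HasFiniteProducts C) (X Y Z : AbObj PC)
    (g : AbHom Y Z) (f : AbHom X Y) :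
  IsAbHom (proj1_sig g ∘ proj1_sig f).
Proof.
case: g f => [g Hg] [f Hf] /=; rewrite /IsAbHom.
rewrite -cmpA Hf cmpA Hg -!cmpA; congr (_ ∘ _).
by rewrite pair2_cmp -!cmpA fst2_pair2 snd2_pair2.
Qed.

Definition ab_id (C : Category) (PC : HasFiniteProducts C) (A : AbObj PC) :
  AbHom A A := exist _ (idm (ab_ob A)) (ab_idP A).

Definition ab_cmp (C : Category) (PC : HasFiniteProducts C) (X Y Z : AbObj PC)
    (g : AbHom Y Z) (f : AbHom X Y) : AbHom X Z :=
  exist _ (proj1_sig g ∘ proj1_sig f) (ab_cmpP g f).

Lemma ab_cmpA (C : Category) (PC : HasFiniteProducts C) (X Y Z W : AbObj PC)
    (h : AbHom Z W) (g : AbHom Y Z) (f : AbHom X Y) :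
  ab_cmp h (ab_cmp g f) = ab_cmp (ab_cmp h g) f.
Proof. by apply: sig_eq; exact: cmpA. Qed.

Lemma ab_cmp1m (C : Category) (PC : HasFiniteProducts C) (X Y : AbObj PC)
  (f : AbHom X Y) : ab_cmp (ab_id Y) f = f.
Proof. by apply: sig_eq; exact: cmp1m. Qed.

Lemma ab_cmpm1 (C : Category) (PC : HasFiniteProducts C) (X Y : AbObj PC)
  (f : AbHom X Y) : ab_cmp f (ab_id X) = f.
Proof. by apply: sig_eq; exact: cmpm1. Qed.

Definition Ab (C : Category) (PC : HasFiniteProducts C) : Category :=
  {| Ob := AbObj PC; Hom := @AbHom C PC; idm := @ab_id C PC;
     cmp := @ab_cmp C PC; cmpA := @ab_cmpA C PC;
     cmp1m := @ab_cmp1m C PC; cmpm1 := @ab_cmpm1 C PC |}.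

Definition ab_forget (C : Category) (PC : HasFiniteProducts C) :
    Functor (Ab PC) C :=
  {| fob := fun A : Ab PC => ab_ob A;
     fmap := fun A B (f : @Hom (Ab PC) A B) => proj1_sig f;
     fmap1 := fun A => erefl; fmapM := fun X Y Z g f => erefl |}.

(* Canonical comparison from the product of the [F (X i)] to the image of the
   product of the [X i]; it is invertible since [F] preserves products. *)
Definition pcomp (C D : Category) (PC : HasFiniteProducts C)
    (PD : HasFiniteProducts D) (F : Functor C D)
    (PF : PreservesFiniteProducts F) (I : finType) (X : I -> C) :
    Hom (product PD (fun i => F (X i))) (F (product PC X)) :=
  lift (PF I X (product PC X) (productP PC X)) (proj _).

Definition pcomp0 (C D : Category) (PC : HasFiniteProducts C)
    (PD : HasFiniteProducts D) (F : Functor C D)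
    (PF : PreservesFiniteProducts F) :
    Hom (terminal PD) (F (terminal PC)) :=
  lift (PF _ (@no_ob C) _ (productP PC (@no_ob C)))
    (fun i => match i with end).

Definition abF_add (C D : Category) (PC : HasFiniteProducts C)
    (PD : HasFiniteProducts D) (F : Functor C D)
    (PF : PreservesFiniteProducts F) (A : AbObj PC) :
    Hom (power PD bool (F A)) (F A) :=
  fmap F (ab_add A) ∘ pcomp PC PD PF (fun _ : bool => ab_ob A).

Definition abF_zero (C D : Category) (PC : HasFiniteProducts C)
    (PD : HasFiniteProducts D) (F : Functor C D)
    (PF : PreservesFiniteProducts F) (A : AbObj PC) :
    Hom (terminal PD) (F A) :=
  fmap F (ab_zero A) ∘ pcomp0 PC PD PF.

Lemma pcomp_fst (C D : Category) (PC : HasFiniteProducts C)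
    (PD : HasFiniteProducts D) (F : Functor C D)
    (PF : PreservesFiniteProducts F) (A : C) :
  fmap F (fst2 PC A) ∘ pcomp PC PD PF (fun _ => A) = fst2 PD (F A).
Proof. exact: (liftE (PF _ _ _ (productP PC (fun _ : bool => A))) _ true). Qed.

Lemma pcomp_snd (C D : Category) (PC : HasFiniteProducts C)
    (PD : HasFiniteProducts D) (F : Functor C D)
    (PF : PreservesFiniteProducts F) (A : C) :
  fmap F (snd2 PC A) ∘ pcomp PC PD PF (fun _ => A) = snd2 PD (F A).
Proof. exact: (liftE (PF _ _ _ (productP PC (fun _ : bool => A))) _ false). Qed.

Lemma pcomp_proj3 (C D : Category) (PC : HasFiniteProducts C)
    (PD : HasFiniteProducts D) (F : Functor C D)
    (PF : PreservesFiniteProducts F) (A : C) (i : 'I_3) :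
  fmap F (proj3 PC A i) ∘ pcomp PC PD PF (fun _ => A) = proj3 PD (F A) i.
Proof. exact: (liftE (PF _ _ _ (productP PC (fun _ : 'I_3 => A))) _ i). Qed.

Lemma pcomp_pair2 (C D : Category) (PC : HasFiniteProducts C)
    (PD : HasFiniteProducts D) (F : Functor C D)
    (PF : PreservesFiniteProducts F) (X A : C) (f g : Hom X A) :
  pcomp PC PD PF (fun _ : bool => A) ∘ pair2 PD (fmap F f) (fmap F g)
    = fmap F (pair2 PC f g).
Proof.
apply: (product_uniq (PF _ _ _ (productP PC (fun _ : bool => A)))) => i.
rewrite cmpA -fmapM /=; case: i.
  by rewrite -/(fst2 PC A) pcomp_fst fst2_pair2 fst2_pair2.
by rewrite -/(snd2 PC A) pcomp_snd snd2_pair2 snd2_pair2.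
Qed.

Lemma abF_add_pair2 (C D : Category) (PC : HasFiniteProducts C)
    (PD : HasFiniteProducts D) (F : Functor C D)
    (PF : PreservesFiniteProducts F) (A : AbObj PC) (X : C)
    (f g : Hom X (ab_ob A)) :
  abF_add PD PF A ∘ pair2 PD (fmap F f) (fmap F g)
    = fmap F (ab_add A ∘ pair2 PC f g).
Proof. by rewrite /abF_add -cmpA pcomp_pair2 fmapM. Qed.

Lemma abF_zero_terminal (C D : Category) (PC : HasFiniteProducts C)
    (PD : HasFiniteProducts D) (F : Functor C D)
    (PF : PreservesFiniteProducts F) (A : AbObj PC) (X : C) :
  abF_zero PD PF A ∘ to_terminal PD (F X)
    = fmap F (ab_zero A ∘ to_terminal PC X).
Proof.
rewrite /abF_zero -cmpA fmapM; congr (_ ∘ _).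
by apply: (product_uniq (PF _ _ _ (productP PC (@no_ob C)))) => -[].
Qed.

Section AbF.
Context (C D : Category) (PC : HasFiniteProducts C) (PD : HasFiniteProducts D)
  (F : Functor C D) (PF : PreservesFiniteProducts F) (A : AbObj PC).

Lemma abF_addA :
  let p i := proj3 PD (F A) i in
  let p0 := p (@Ordinal 3 0 isT) in
  let p1 := p (@Ordinal 3 1 isT) in
  let p2 := p (@Ordinal 3 2 isT) in
  abF_add PD PF A ∘ pair2 PD (abF_add PD PF A ∘ pair2 PD p0 p1) p2
    = abF_add PD PF A ∘ pair2 PD p0 (abF_add PD PF A ∘ pair2 PD p1 p2).
Proof.
move=> p p0 p1 p2; rewrite /p2 /p1 /p0 /p -!(pcomp_proj3 PC PD PF).
rewrite -!pair2_cmp !cmpA !abF_add_pair2 -!pair2_cmp !cmpA !abF_add_pair2.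
by rewrite (ab_addA A).
Qed.

Lemma abF_addC :
  abF_add PD PF A ∘ pair2 PD (snd2 PD (F A)) (fst2 PD (F A)) = abF_add PD PF A.
Proof.
rewrite -(pcomp_fst PC PD PF) -(pcomp_snd PC PD PF).
by rewrite -pair2_cmp cmpA abF_add_pair2 ab_addC.
Qed.

Lemma abF_add0 :
  abF_add PD PF A ∘
    pair2 PD (abF_zero PD PF A ∘ to_terminal PD (F A)) (idm (F A)) = idm (F A).
Proof. by rewrite abF_zero_terminal -fmap1 abF_add_pair2 ab_add0. Qed.

Lemma abF_addN :
  abF_add PD PF A ∘ pair2 PD (fmap F (ab_opp A)) (idm (F A))
    = abF_zero PD PF A ∘ to_terminal PD (F A).
Proof. by rewrite abF_zero_terminal -fmap1 abF_add_pair2 ab_addN. Qed.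

Definition abF_ob : AbObj PD :=
  {| ab_ob := F A; ab_add := abF_add PD PF A; ab_zero := abF_zero PD PF A;
     ab_opp := fmap F (ab_opp A); ab_addA := abF_addA; ab_addC := abF_addC;
     ab_add0 := abF_add0; ab_addN := abF_addN |}.
End AbF.

Lemma abF_homP (C D : Category) (PC : HasFiniteProducts C)
    (PD : HasFiniteProducts D) (F : Functor C D)
    (PF : PreservesFiniteProducts F) (A B : AbObj PC) (f : AbHom A B) :
  IsAbHom (fmap F (proj1_sig f) : Hom (abF_ob PD PF A) (abF_ob PD PF B)).
Proof.
rewrite /IsAbHom /= -(pcomp_fst PC PD PF) -(pcomp_snd PC PD PF) !cmpA -!fmapM.
by rewrite -pair2_cmp cmpA abF_add_pair2 -(proj2_sig f).
Qed.

Definition abF_hom (C D : Category) (PC : HasFiniteProducts C)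
    (PD : HasFiniteProducts D) (F : Functor C D)
    (PF : PreservesFiniteProducts F) (A B : AbObj PC) (f : AbHom A B) :
    AbHom (abF_ob PD PF A) (abF_ob PD PF B) :=
  exist _ (fmap F (proj1_sig f)) (abF_homP PD PF f).

Lemma abF_hom1 (C D : Category) (PC : HasFiniteProducts C)
    (PD : HasFiniteProducts D) (F : Functor C D)
    (PF : PreservesFiniteProducts F) (A : AbObj PC) :
  abF_hom PD PF (ab_id A) = ab_id (abF_ob PD PF A).
Proof. by apply: sig_eq; exact: fmap1. Qed.

Lemma abF_homM (C D : Category) (PC : HasFiniteProducts C)
    (PD : HasFiniteProducts D) (F : Functor C D)
    (PF : PreservesFiniteProducts F) (X Y Z : AbObj PC)
    (g : AbHom Y Z) (f : AbHom X Y) :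
  abF_hom PD PF (ab_cmp g f) = ab_cmp (abF_hom PD PF g) (abF_hom PD PF f).
Proof. by apply: sig_eq; exact: fmapM. Qed.

Definition ab_functor (C D : Category) (PC : HasFiniteProducts C)
    (PD : HasFiniteProducts D) (F : Functor C D)
    (PF : PreservesFiniteProducts F) : Functor (Ab PC) (Ab PD) :=
  {| fob := fun A : Ab PC => abF_ob PD PF A : Ab PD;
     fmap := fun A B (f : @Hom (Ab PC) A B) => abF_hom PD PF f;
     fmap1 := @abF_hom1 C D PC PD F PF; fmapM := @abF_homM C D PC PD F PF |}.

Record Comonad (C : Category) := {
  cofun :> Functor C C;
  eps : NatTrans cofun (fid C);
  delta : NatTrans cofun (cofun ∙ cofun);
  comonad_epsl : forall X, eps (cofun X) ∘ delta X = idm (cofun X);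
  comonad_epsr : forall X, fmap cofun (eps X) ∘ delta X = idm (cofun X);
  comonad_deltaA : forall X,
    delta (cofun X) ∘ delta X = fmap cofun (delta X) ∘ delta X }.
Arguments eps {C} c.
Arguments delta {C} c.

Record CoAlgObj (C : Category) (G : Comonad C) := {
  co_ob :> C;
  co_act : Hom co_ob (G co_ob);
  co_eps : eps G co_ob ∘ co_act = idm co_ob;
  co_delta : delta G co_ob ∘ co_act = fmap G co_act ∘ co_act }.
Arguments co_act {C G} c.

Definition CoAlgHom (C : Category) (G : Comonad C) (A B : CoAlgObj G) :=
  {f : Hom (co_ob A) (co_ob B) | co_act B ∘ f = fmap G f ∘ co_act A}.

Lemma co_idP (C : Category) (G : Comonad C) (A : CoAlgObj G) :
  co_act A ∘ idm (co_ob A) = fmap G (idm (co_ob A)) ∘ co_act A.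
Proof. by rewrite fmap1 cmpm1 cmp1m. Qed.

Lemma co_cmpP (C : Category) (G : Comonad C) (X Y Z : CoAlgObj G)
    (g : CoAlgHom Y Z) (f : CoAlgHom X Y) :
  co_act Z ∘ (proj1_sig g ∘ proj1_sig f)
    = fmap G (proj1_sig g ∘ proj1_sig f) ∘ co_act X.
Proof.
by rewrite cmpA (proj2_sig g) -cmpA (proj2_sig f) cmpA fmapM.
Qed.

Definition co_id (C : Category) (G : Comonad C) (A : CoAlgObj G) :
  CoAlgHom A A := exist _ (idm (co_ob A)) (co_idP A).

Definition co_cmp (C : Category) (G : Comonad C) (X Y Z : CoAlgObj G)
    (g : CoAlgHom Y Z) (f : CoAlgHom X Y) : CoAlgHom X Z :=
  exist _ (proj1_sig g ∘ proj1_sig f) (co_cmpP g f).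

Lemma co_cmpA (C : Category) (G : Comonad C) (X Y Z W : CoAlgObj G)
    (h : CoAlgHom Z W) (g : CoAlgHom Y Z) (f : CoAlgHom X Y) :
  co_cmp h (co_cmp g f) = co_cmp (co_cmp h g) f.
Proof. by apply: sig_eq; exact: cmpA. Qed.

Lemma co_cmp1m (C : Category) (G : Comonad C) (X Y : CoAlgObj G)
  (f : CoAlgHom X Y) : co_cmp (co_id Y) f = f.
Proof. by apply: sig_eq; exact: cmp1m. Qed.

Lemma co_cmpm1 (C : Category) (G : Comonad C) (X Y : CoAlgObj G)
  (f : CoAlgHom X Y) : co_cmp f (co_id X) = f.
Proof. by apply: sig_eq; exact: cmpm1. Qed.

Definition CoAlg (C : Category) (G : Comonad C) : Category :=
  {| Ob := CoAlgObj G; Hom := @CoAlgHom C G; idm := @co_id C G;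
     cmp := @co_cmp C G; cmpA := @co_cmpA C G;
     cmp1m := @co_cmp1m C G; cmpm1 := @co_cmpm1 C G |}.

Definition coalg_forget (C : Category) (G : Comonad C) :
    Functor (CoAlg G) C :=
  {| fob := fun A : CoAlg G => co_ob A;
     fmap := fun A B (f : @Hom (CoAlg G) A B) => proj1_sig f;
     fmap1 := fun A => erefl; fmapM := fun X Y Z g f => erefl |}.

Definition cofree_ob (C : Category) (G : Comonad C) (X : C) : CoAlgObj G :=
  {| co_ob := G X; co_act := delta G X;
     co_eps := comonad_epsl G X; co_delta := comonad_deltaA G X |}.

Lemma cofree_homP (C : Category) (G : Comonad C) (X Y : C) (f : Hom X Y) :
  delta G Y ∘ fmap G f = fmap G (fmap G f) ∘ delta G X.
Proof. exact: ntN. Qed.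

Definition cofree_hom (C : Category) (G : Comonad C) (X Y : C) (f : Hom X Y) :
    CoAlgHom (cofree_ob G X) (cofree_ob G Y) :=
  exist _ (fmap G f) (cofree_homP G f).

Lemma cofree_hom1 (C : Category) (G : Comonad C) (X : C) :
  cofree_hom G (idm X) = co_id (cofree_ob G X).
Proof. by apply: sig_eq; exact: fmap1. Qed.

Lemma cofree_homM (C : Category) (G : Comonad C) (X Y Z : C)
    (g : Hom Y Z) (f : Hom X Y) :
  cofree_hom G (g ∘ f) = co_cmp (cofree_hom G g) (cofree_hom G f).
Proof. by apply: sig_eq; exact: fmapM. Qed.

Definition cofree (C : Category) (G : Comonad C) : Functor C (CoAlg G) :=
  {| fob := fun X : C => cofree_ob G X : CoAlg G;
     fmap := fun X Y (f : Hom X Y) => cofree_hom G f;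
     fmap1 := @cofree_hom1 C G; fmapM := @cofree_homM C G |}.

Definition cofree_unit_hom (C : Category) (G : Comonad C) (A : CoAlg G) :
    @Hom (CoAlg G) A (cofree G (coalg_forget G A)) :=
  exist (fun f => co_act (cofree_ob G (co_ob A)) ∘ f = fmap G f ∘ co_act A)
    (co_act A) (co_delta A).

Lemma cofree_unitN (C : Category) (G : Comonad C) (A B : CoAlg G)
    (f : Hom A B) :
  cofree_unit_hom B ∘ f
    = fmap (cofree G) (fmap (coalg_forget G) f) ∘ cofree_unit_hom A.
Proof. by apply: sig_eq; exact: (proj2_sig f). Qed.

Definition cofree_unit (C : Category) (G : Comonad C) :
    NatTrans (fid (CoAlg G)) (cofree G ∙ coalg_forget G) :=
  @Build_NatTrans _ _ (fid (CoAlg G)) (cofree G ∙ coalg_forget G)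
    (@cofree_unit_hom C G) (@cofree_unitN C G).

Definition cofree_counit (C : Category) (G : Comonad C) :
    NatTrans (coalg_forget G ∙ cofree G) (fid C) :=
  @Build_NatTrans _ _ (coalg_forget G ∙ cofree G) (fid C)
    (fun X => eps G X) (fun X Y f => ntN (eps G) f).

Lemma cofree_triangleL (C : Category) (G : Comonad C) (A : CoAlg G) :
  cofree_counit G (coalg_forget G A) ∘ fmap (coalg_forget G) (cofree_unit G A)
    = idm (coalg_forget G A).
Proof. exact: co_eps. Qed.

Lemma cofree_triangleR (C : Category) (G : Comonad C) (X : C) :
  fmap (cofree G) (cofree_counit G X) ∘ cofree_unit G (cofree G X)
    = idm (cofree G X).
Proof. by apply: sig_eq; exact: comonad_epsr. Qed.

Definition cofree_adj (C : Category) (G : Comonad C) :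
    Adjunction (coalg_forget G) (cofree G) :=
  {| unit := cofree_unit G; counit := cofree_counit G;
     triangleL := @cofree_triangleL C G; triangleR := @cofree_triangleR C G |}.

Section Comparison.
Context (C D : Category) (L : Functor C D) (R : Functor D C)
  (adj : Adjunction L R).

Lemma adj_deltaN (X Y : D) (f : Hom X Y) :
  fmap L (unit adj (R Y)) ∘ fmap (L ∙ R) f
    = fmap (L ∙ R ∙ (L ∙ R)) f ∘ fmap L (unit adj (R X)).
Proof. by rewrite /= -!fmapM; congr fmap; exact: (ntN (unit adj)). Qed.

Definition adj_delta : NatTrans (L ∙ R) ((L ∙ R) ∙ (L ∙ R)) :=
  @Build_NatTrans _ _ (L ∙ R) ((L ∙ R) ∙ (L ∙ R))
    (fun X => fmap L (unit adj (R X))) adj_deltaN.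

Lemma adj_epsl (X : D) :
  counit adj ((L ∙ R) X) ∘ adj_delta X = idm ((L ∙ R) X).
Proof. exact: (triangleL adj (R X)). Qed.

Lemma adj_epsr (X : D) :
  fmap (L ∙ R) (counit adj X) ∘ adj_delta X = idm ((L ∙ R) X).
Proof. by rewrite /= -fmapM (triangleR adj) fmap1. Qed.

Lemma adj_deltaA (X : D) :
  adj_delta ((L ∙ R) X) ∘ adj_delta X
    = fmap (L ∙ R) (adj_delta X) ∘ adj_delta X.
Proof. by rewrite /= -!fmapM; congr fmap; exact: (ntN (unit adj)). Qed.

Definition adj_comonad : Comonad D :=
  {| cofun := L ∙ R; eps := counit adj; delta := adj_delta;
     comonad_epsl := adj_epsl; comonad_epsr := adj_epsr;
     comonad_deltaA := adj_deltaA |}.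

Lemma comparison_delta (X : C) :
  delta adj_comonad (L X) ∘ fmap L (unit adj X)
    = fmap adj_comonad (fmap L (unit adj X)) ∘ fmap L (unit adj X).
Proof. by rewrite /= -!fmapM; congr fmap; exact: (ntN (unit adj)). Qed.

Definition comparison_ob (X : C) : CoAlgObj adj_comonad :=
  @Build_CoAlgObj D adj_comonad (L X) (fmap L (unit adj X))
    (triangleL adj X) (comparison_delta X).

Lemma comparison_homP (X Y : C) (f : Hom X Y) :
  co_act (comparison_ob Y) ∘ fmap L f
    = fmap adj_comonad (fmap L f) ∘ co_act (comparison_ob X).
Proof. by rewrite /= -!fmapM; congr fmap; exact: (ntN (unit adj)). Qed.

Definition comparison_hom (X Y : C) (f : Hom X Y) :
    CoAlgHom (comparison_ob X) (comparison_ob Y) :=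
  exist _ (fmap L f) (comparison_homP f).

Lemma comparison_hom1 (X : C) :
  comparison_hom (idm X) = co_id (comparison_ob X).
Proof. by apply: sig_eq; exact: fmap1. Qed.

Lemma comparison_homM (X Y Z : C) (g : Hom Y Z) (f : Hom X Y) :
  comparison_hom (g ∘ f) = co_cmp (comparison_hom g) (comparison_hom f).
Proof. by apply: sig_eq; exact: fmapM. Qed.

Definition comparison : Functor C (CoAlg adj_comonad) :=
  {| fob := fun X : C => comparison_ob X : CoAlg adj_comonad;
     fmap := fun X Y (f : Hom X Y) => comparison_hom f;
     fmap1 := comparison_hom1; fmapM := comparison_homM |}.
End Comparison.

Definition Comonadic (C D : Category) (L : Functor C D) : Prop :=
  exists (R : Functor D C) (adj : Adjunction L R),
    IsEquivalence (comparison adj).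

(* The square
         V'
     D' ---> D
   U'|       | U
     v       v
     C' ---> C
         V
   commuting up to the natural isomorphism [sq_iso]. *)
Record Square (D' D C' C : Category) (V' : Functor D' D) (U' : Functor D' C')
    (V : Functor C' C) (U : Functor D C) := {
  sq_iso : NatTrans (V ∙ U') (U ∙ V');
  sq_isoP : IsNatIso sq_iso }.

(* Objects of the pseudo-pullback (the homotopy pullback of categories), with
   an isomorphism, not an equality, between the two images in [C]. *)

Record PBObj (D C' C : Category) (V : Functor C' C) (U : Functor D C) := {
  pb_l : C';
  pb_r : D;
  pb_iso : Hom (V pb_l) (U pb_r);
  pb_isoP : IsIso pb_iso }.

Section Pullback.
Context (D C' C : Category) (V : Functor C' C) (U : Functor D C).

Definition PBHom (P Q : PBObj V U) :=
  {f : Hom (pb_l P) (pb_l Q) * Hom (pb_r P) (pb_r Q) |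
     fmap U f.2 ∘ pb_iso P = pb_iso Q ∘ fmap V f.1}.

Lemma pb_idP (P : PBObj V U) :
  fmap U (idm (pb_r P)) ∘ pb_iso P = pb_iso P ∘ fmap V (idm (pb_l P)).
Proof. by rewrite !fmap1 cmp1m cmpm1. Qed.

Definition pb_id (P : PBObj V U) : PBHom P P :=
  exist _ (idm (pb_l P), idm (pb_r P)) (pb_idP P).

Lemma pb_cmpP (P Q S : PBObj V U) (g : PBHom Q S) (f : PBHom P Q) :
  fmap U ((proj1_sig g).2 ∘ (proj1_sig f).2) ∘ pb_iso P
    = pb_iso S ∘ fmap V ((proj1_sig g).1 ∘ (proj1_sig f).1).
Proof.
by rewrite !fmapM -cmpA (proj2_sig f) cmpA (proj2_sig g) cmpA.
Qed.

Definition pb_cmp (P Q S : PBObj V U) (g : PBHom Q S) (f : PBHom P Q) :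
    PBHom P S :=
  exist _ ((proj1_sig g).1 ∘ (proj1_sig f).1, (proj1_sig g).2 ∘ (proj1_sig f).2)
    (pb_cmpP g f).

Lemma pb_cmpA (P Q S T : PBObj V U) (h : PBHom S T) (g : PBHom Q S)
    (f : PBHom P Q) : pb_cmp h (pb_cmp g f) = pb_cmp (pb_cmp h g) f.
Proof. by apply: sig_eq; rewrite /= !cmpA. Qed.

Lemma pb_cmp1m (P Q : PBObj V U) (f : PBHom P Q) : pb_cmp (pb_id Q) f = f.
Proof. by apply: sig_eq; rewrite /= !cmp1m; case: (proj1_sig f). Qed.

Lemma pb_cmpm1 (P Q : PBObj V U) (f : PBHom P Q) : pb_cmp f (pb_id P) = f.
Proof. by apply: sig_eq; rewrite /= !cmpm1; case: (proj1_sig f). Qed.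

Definition Pullback : Category :=
  {| Ob := PBObj V U; Hom := PBHom; idm := pb_id; cmp := pb_cmp;
     cmpA := pb_cmpA; cmp1m := pb_cmp1m; cmpm1 := pb_cmpm1 |}.

Context (D' : Category) (V' : Functor D' D) (U' : Functor D' C')
  (S : Square V' U' V U).

Definition to_pb_ob (X : D') : PBObj V U :=
  {| pb_l := U' X; pb_r := V' X; pb_iso := sq_iso S X;
     pb_isoP := sq_isoP S X |}.

Lemma to_pb_homP (X Y : D') (f : Hom X Y) :
  fmap U (fmap V' f) ∘ sq_iso S X = sq_iso S Y ∘ fmap V (fmap U' f).
Proof. by symmetry; exact: (ntN (sq_iso S)). Qed.

Definition to_pb_hom (X Y : D') (f : Hom X Y) :
    PBHom (to_pb_ob X) (to_pb_ob Y) :=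
  exist _ (fmap U' f, fmap V' f) (to_pb_homP f).

Lemma to_pb_hom1 (X : D') : to_pb_hom (idm X) = pb_id (to_pb_ob X).
Proof. by apply: sig_eq; rewrite /= !fmap1. Qed.

Lemma to_pb_homM (X Y Z : D') (g : Hom Y Z) (f : Hom X Y) :
  to_pb_hom (g ∘ f) = pb_cmp (to_pb_hom g) (to_pb_hom f).
Proof. by apply: sig_eq; rewrite /= !fmapM. Qed.

Definition to_pullback : Functor D' Pullback :=
  {| fob := fun X : D' => to_pb_ob X : Pullback;
     fmap := fun X Y (f : Hom X Y) => to_pb_hom f;
     fmap1 := to_pb_hom1; fmapM := to_pb_homM |}.

Definition IsCartesian : Prop := IsEquivalence to_pullback.
End Pullback.

Section Mates.
Context (D' D C' C : Category) (V' : Functor D' D) (U' : Functor D' C')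
  (V : Functor C' C) (U : Functor D C) (S : Square V' U' V U).

Section Left.
Context (T' : Functor C' D') (T : Functor C D)
  (adj' : Adjunction T' U') (adj : Adjunction T U).

Definition left_mate_hom (X : C') : Hom (T (V X)) (V' (T' X)) :=
  counit adj (V' (T' X)) ∘ fmap T (sq_iso S (T' X))
    ∘ fmap T (fmap V (unit adj' X)).

Lemma left_mateN (X Y : C') (f : Hom X Y) :
  left_mate_hom Y ∘ fmap (T ∙ V) f = fmap (V' ∙ T') f ∘ left_mate_hom X.
Proof.
have e1 := ntN (unit adj') f; rewrite /= in e1.
have e2 := ntN (sq_iso S) (fmap T' f); rewrite /= in e2.
have e3 := ntN (counit adj) (fmap V' (fmap T' f)); rewrite /= in e3.
rewrite /left_mate_hom /= -[LHS]cmpA -fmapM -fmapM e1 (fmapM V) fmapM cmpA.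
by rewrite -(cmpA (counit adj _)) -fmapM e2 fmapM (cmpA (counit adj _)) e3 !cmpA.
Qed.

Definition left_mate : NatTrans (T ∙ V) (V' ∙ T') :=
  @Build_NatTrans _ _ (T ∙ V) (V' ∙ T') left_mate_hom left_mateN.

(* In particular [T'] lifts [T], up to the isomorphism [left_mate]. *)
Definition IsDistributive : Prop := IsNatIso left_mate.
End Left.

Section Right.
Context (R' : Functor D D') (R : Functor C C')
  (adj' : Adjunction V' R') (adj : Adjunction V R).

Definition right_mate_hom (A : D) : Hom (U' (R' A)) (R (U A)) :=
  fmap R (fmap U (counit adj' A)) ∘ fmap R (sq_iso S (R' A))
    ∘ unit adj (U' (R' A)).

Lemma right_mateN (A B : D) (f : Hom A B) :
  right_mate_hom B ∘ fmap (U' ∙ R') f = fmap (R ∙ U) f ∘ right_mate_hom A.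
Proof.
have e1 := ntN (unit adj) (fmap U' (fmap R' f)); rewrite /= in e1.
have e2 := ntN (sq_iso S) (fmap R' f); rewrite /= in e2.
have e3 := ntN (counit adj') f; rewrite /= in e3.
rewrite /right_mate_hom /= -cmpA e1 !cmpA -!fmapM -cmpA e2 cmpA -fmapM.
by rewrite e3 fmapM.
Qed.

Definition right_mate : NatTrans (U' ∙ R') (R ∙ U) :=
  @Build_NatTrans _ _ (U' ∙ R') (R ∙ U) right_mate_hom right_mateN.
End Right.
End Mates.

Section AbSquare.
Context (C D : Category) (PD : HasFiniteProducts D) (F : Functor C D)
  (cr : CreatesFiniteProducts F).

Definition ab_created : Functor (Ab (creates_has cr PD)) (Ab PD) :=
  ab_functor (creates_has cr PD) PD (creates_preserves cr PD).

Lemma ab_square_isoN (A B : Ab (creates_has cr PD)) (f : Hom A B) :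
  idm (F (ab_ob B)) ∘ fmap (F ∙ ab_forget (creates_has cr PD)) f
    = fmap (ab_forget PD ∙ ab_created) f ∘ idm (F (ab_ob A)).
Proof. by rewrite cmp1m cmpm1. Qed.

(* Both composites send [A] to [F (ab_ob A)]: the square commutes strictly. *)
Definition ab_square_iso :
    NatTrans (F ∙ ab_forget (creates_has cr PD)) (ab_forget PD ∙ ab_created) :=
  @Build_NatTrans _ _ (F ∙ ab_forget (creates_has cr PD))
    (ab_forget PD ∙ ab_created) (fun A => idm (F (ab_ob A))) ab_square_isoN.

Lemma ab_square_isoP : IsNatIso ab_square_iso.
Proof. by move=> A; exists (idm _); rewrite cmp1m. Qed.

Definition ab_square :
    Square ab_created (ab_forget (creates_has cr PD)) F (ab_forget PD) :=
  {| sq_iso := ab_square_iso; sq_isoP := ab_square_isoP |}.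
End AbSquare.

(* Main.v *)
(** The coaction on a product of coalgebras is forced by the fact that [G]
    preserves products, which gives (1). The cofree functor is a right adjoint,
    hence preserves products, and the unit and the counit of the cofree
    adjunction are additive on abelian group objects, so the adjunction passes
    to a comonad [M] on [Ab C] that is [G] on carriers. An [M]-coalgebra is an
    abelian group object [A] with an additive coaction of [G]; additivity says
    exactly that addition, zero and opposite are maps of [G]-coalgebras, so [A]
    lifts to [Ab (CoAlg G)]. This gives (2). The remaining parts are:
    (3) when [U] is full, every coaction on the carrier of an abelian group
    object is additive;
    (4) the mate of the lifted cofree adjunction is an identity, and right
    adjoints are unique;
    (5) the coaction of a coalgebra [X] followed by [G] of the unit extends
    uniquely to an additive coaction on [D X], and the resulting lift is the
    free abelian group object on [X]. *)
From mathcomp Require Import ssreflect ssrfun ssrbool eqtype ssrnat fintype.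
From Stdlib Require Import ProofIrrelevance IndefiniteDescription.
From Stdlib Require Import FunctionalExtensionality.
Require Import Defs.
Set Implicit Arguments.
Unset Strict Implicit.
Unset Printing Implicit Defensive.
Local Open Scope cat_scope.

(** * Faithful functors and isomorphisms *)

Definition Faithful (C D : Category) (F : Functor C D) : Prop :=
  forall X Y (f g : Hom X Y), fmap F f = fmap F g -> f = g.

Lemma iso_idm (C : Category) (X : C) : IsIso (idm X).
Proof. by exists (idm X); rewrite cmp1m. Qed.

Lemma iso_cmp (C : Category) (X Y Z : C) (g : Hom Y Z) (f : Hom X Y) :
  IsIso g -> IsIso f -> IsIso (g ∘ f).
Proof.
move=> [g' [g1 g2]] [f' [f1 f2]]; exists (f' ∘ g'); split.
  by rewrite -cmpA (cmpA g') g1 cmp1m.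
by rewrite -cmpA (cmpA f) f2 cmp1m.
Qed.

Lemma iso_fmap (C D : Category) (F : Functor C D) (X Y : C) (f : Hom X Y) :
  IsIso f -> IsIso (fmap F f).
Proof.
by move=> [g [e1 e2]]; exists (fmap F g); rewrite -!fmapM e1 e2 !fmap1.
Qed.

(** Inverting both components turns the compatibility square of [f] into that of its inverse. *)
Lemma pullback_iso (C1 C2 C3 : Category) (F : Functor C1 C3) (K : Functor C2 C3)
    (P Q : Pullback F K) (f : Hom P Q) :
  IsIso (proj1_sig f).1 -> IsIso (proj1_sig f).2 -> IsIso f.
Proof.
case: f => [[f1 f2] /= Hf] [g1 [gf1 fg1]] [g2 [gf2 fg2]].
have Hg : fmap K g2 ∘ pb_iso Q = pb_iso P ∘ fmap F g1.
  rewrite -(cmpm1 (pb_iso Q)) -fmap1 -fg1 fmapM !cmpA -(cmpA (fmap K g2)) -Hf.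
  by rewrite cmpA -fmapM gf2 fmap1 cmp1m.
exists (exist _ (g1, g2) Hg : @Hom (Pullback F K) Q P).
by split; apply: sig_eq; rewrite /= ?gf1 ?gf2 ?fg1 ?fg2.
Qed.

(** * Equivalences from full faithfulness and essential surjectivity *)

Section EquivalenceCriterion.
Context (C D : Category) (F : Functor C D) (FF : FullyFaithful F)
  (ES : forall Y : D, exists X (f : Hom (F X) Y), IsIso f).

Let pre (X Y : C) (g : Hom (F X) (F Y)) : {f : Hom X Y | fmap F f = g}.
Proof.
apply: constructive_indefinite_description.
by have [f [e _]] := FF g; exists f.
Qed.

Lemma fully_faithful_faithful : Faithful F.
Proof.
move=> X Y f g e; have [h [_ u]] := FF (fmap F g).
by rewrite -(u f e) -(u g).
Qed.

Let inv_ob (Y : D) : {X : C | exists f : Hom (F X) Y, IsIso f}.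
Proof. exact: constructive_indefinite_description (ES Y). Qed.

Let k (Y : D) : C := proj1_sig (inv_ob Y).

Let inv_to (Y : D) : {f : Hom (F (k Y)) Y | IsIso f}.
Proof. exact: constructive_indefinite_description (proj2_sig (inv_ob Y)). Qed.

Let d (Y : D) : Hom (F (k Y)) Y := proj1_sig (inv_to Y).

Let inv_from (Y : D) :
  {g : Hom Y (F (k Y)) | g ∘ d Y = idm _ /\ d Y ∘ g = idm Y}.
Proof. exact: constructive_indefinite_description (proj2_sig (inv_to Y)). Qed.

Let e (Y : D) : Hom Y (F (k Y)) := proj1_sig (inv_from Y).

Let ed (Y : D) : e Y ∘ d Y = idm _. Proof. exact: (proj2_sig (inv_from Y)).1. Qed.
Let de (Y : D) : d Y ∘ e Y = idm _. Proof. exact: (proj2_sig (inv_from Y)).2. Qed.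

(** Conjugation by the chosen isomorphisms, pulled back along [F] by fullness; the functor laws are
    then checked after applying [F], by faithfulness. *)
Let kmap (X Y : D) (f : Hom X Y) : Hom (k X) (k Y) :=
  proj1_sig (pre (e Y ∘ f ∘ d X)).

Let kmapE (X Y : D) (f : Hom X Y) : fmap F (kmap f) = e Y ∘ f ∘ d X.
Proof. exact: proj2_sig (pre _). Qed.

Let kmap1 (X : D) : kmap (idm X) = idm (k X).
Proof. by apply: fully_faithful_faithful; rewrite kmapE cmpm1 ed fmap1. Qed.

Let kmapM (X Y Z : D) (g : Hom Y Z) (f : Hom X Y) :
  kmap (g ∘ f) = kmap g ∘ kmap f.
Proof.
apply: fully_faithful_faithful; rewrite fmapM !kmapE.
by rewrite -!cmpA (cmpA (d Y)) de cmp1m.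
Qed.

Let K : Functor D C :=
  {| fob := k; fmap := kmap; fmap1 := kmap1; fmapM := kmapM |}.

Let eta (X : C) : {f : Hom X (k (F X)) | fmap F f = e (F X)} := pre (e (F X)).

Let etaN (X Y : C) (f : Hom X Y) :
  proj1_sig (eta Y) ∘ f = fmap (K ∙ F) f ∘ proj1_sig (eta X).
Proof.
apply: fully_faithful_faithful.
rewrite !fmapM (proj2_sig (eta Y)) (proj2_sig (eta X)) kmapE.
by rewrite -!cmpA de cmpm1.
Qed.

Let dN (X Y : D) (f : Hom X Y) : d Y ∘ fmap (F ∙ K) f = f ∘ d X.
Proof. by rewrite /= kmapE !cmpA de cmp1m. Qed.

Lemma equivalence_of_ff_es : IsEquivalence F.
Proof.
exists K,
  (@Build_NatTrans _ _ (fid C) (K ∙ F) (fun X => proj1_sig (eta X)) etaN),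
  (@Build_NatTrans _ _ (F ∙ K) (fid D) d dN); split=> X /=; last first.
  by exists (e X); split; [exact: ed | exact: de].
have [g Hg] := pre (d (F X)); exists g.
by split; apply: fully_faithful_faithful;
  rewrite fmapM Hg (proj2_sig (eta X)) ?de ?ed fmap1.
Qed.
End EquivalenceCriterion.

(** * Left adjoints from universal arrows *)

Section UniversalArrows.
Context (C D : Category) (R : Functor D C) (L0 : C -> D)
  (eta : forall X, Hom X (R (L0 X)))
  (univ : forall X Y (f : Hom X (R Y)),
     exists! g : Hom (L0 X) Y, fmap R g ∘ eta X = f).

Definition extend (X : C) (Y : D) (f : Hom X (R Y)) : Hom (L0 X) Y :=
  proj1_sig (constructive_indefinite_description _ (univ f)).

Lemma extendE (X : C) (Y : D) (f : Hom X (R Y)) : fmap R (extend f) ∘ eta X = f.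
Proof. by rewrite /extend; case: constructive_indefinite_description => g []. Qed.

Lemma extend_uniq (X : C) (Y : D) (g h : Hom (L0 X) Y) :
  fmap R g ∘ eta X = fmap R h ∘ eta X -> g = h.
Proof.
move=> e; have [k [_ u]] := univ (fmap R h ∘ eta X).
by rewrite -(u g e) -(u h).
Qed.

Definition univ_map (X Y : C) (f : Hom X Y) : Hom (L0 X) (L0 Y) :=
  extend (eta Y ∘ f).

Lemma univ_map1 (X : C) : univ_map (idm X) = idm (L0 X).
Proof. by apply: extend_uniq; rewrite extendE fmap1 cmpm1 cmp1m. Qed.

Lemma univ_mapM (X Y Z : C) (g : Hom Y Z) (f : Hom X Y) :
  univ_map (g ∘ f) = univ_map g ∘ univ_map f.
Proof.
by apply: extend_uniq; rewrite extendE fmapM -cmpA extendE !cmpA extendE.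
Qed.

Definition univ_functor : Functor C D :=
  {| fob := L0; fmap := univ_map; fmap1 := univ_map1; fmapM := univ_mapM |}.

Lemma univ_unitN (X Y : C) (f : Hom X Y) :
  eta Y ∘ f = fmap (R ∙ univ_functor) f ∘ eta X.
Proof. by rewrite /= extendE. Qed.

Lemma univ_counitN (X Y : D) (f : Hom X Y) :
  extend (idm (R Y)) ∘ fmap (univ_functor ∙ R) f = f ∘ extend (idm (R X)).
Proof.
by apply: extend_uniq; rewrite !fmapM -!cmpA !extendE cmpA extendE cmp1m cmpm1.
Qed.

Definition univ_unit : NatTrans (fid C) (R ∙ univ_functor) :=
  @Build_NatTrans _ _ (fid C) (R ∙ univ_functor) eta univ_unitN.

Definition univ_counit : NatTrans (univ_functor ∙ R) (fid D) :=
  @Build_NatTrans _ _ (univ_functor ∙ R) (fid D)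
    (fun Y => extend (idm (R Y))) univ_counitN.

Lemma univ_triangleL (X : C) :
  univ_counit (univ_functor X) ∘ fmap univ_functor (univ_unit X)
    = idm (univ_functor X).
Proof.
apply: extend_uniq.
by rewrite fmapM -cmpA /= extendE cmpA extendE fmap1.
Qed.

Definition univ_adj : Adjunction univ_functor R :=
  {| unit := univ_unit; counit := univ_counit; triangleL := univ_triangleL;
     triangleR := fun Y => extendE (idm (R Y)) |}.
End UniversalArrows.

(** * Transposition along an adjunction *)

Section Transpose.
Context (C D : Category) (L : Functor C D) (R : Functor D C)
  (adj : Adjunction L R).

Definition transpose (X : C) (Y : D) (f : Hom X (R Y)) : Hom (L X) Y :=
  counit adj Y ∘ fmap L f.

Lemma transposeE (X : C) (Y : D) (f : Hom X (R Y)) :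
  fmap R (transpose f) ∘ unit adj X = f.
Proof.
have := ntN (unit adj) f; rewrite /= => e.
by rewrite /transpose fmapM -cmpA -e cmpA triangleR cmp1m.
Qed.

Lemma transposeK (X : C) (Y : D) (g : Hom (L X) Y) :
  transpose (fmap R g ∘ unit adj X) = g.
Proof.
have := ntN (counit adj) g; rewrite /= => e.
by rewrite /transpose fmapM cmpA e -cmpA triangleL cmpm1.
Qed.

Lemma transpose_inj (X : C) (Y : D) (g h : Hom (L X) Y) :
  fmap R g ∘ unit adj X = fmap R h ∘ unit adj X -> g = h.
Proof. by move=> e; rewrite -(transposeK g) e transposeK. Qed.

(** A cone over the [R (Y i)] transposes to a cone over the [Y i]; by naturality of the counit,
    transposition commutes with the projections. *)
Lemma right_adjoint_preserves : PreservesFiniteProducts R.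
Proof.
move=> I Y c Hc Q f.
exists (fmap R (lift Hc (fun i => transpose (f i))) ∘ unit adj Q).
split=> [i|h Hh].
  by rewrite /= cmpA -fmapM liftE transposeE.
rewrite -[RHS](transposeE h); congr (fmap R _ ∘ _).
apply: (product_uniq Hc) => i; rewrite liftE -Hh /transpose.
have := ntN (counit adj) (proj c i); rewrite /= => e.
by rewrite cmpA -e fmapM cmpA.
Qed.
End Transpose.

(** * Independence of the right mate from the chosen right adjoint *)

Section MateTransfer.
Context (D' D C' C : Category) (V' : Functor D' D) (U' : Functor D' C')
  (V : Functor C' C) (U : Functor D C) (S : Square V' U' V U)
  (R : Functor C C') (adj : Adjunction V R)
  (R1 R2 : Functor D D') (adj1 : Adjunction V' R1) (adj2 : Adjunction V' R2).

(** The canonical comparison of two right adjoints: the map that corresponds under [adj1] to the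
    counit of [adj2]. *)
Definition right_adjoint_cmp (A : D) : Hom (R2 A) (R1 A) :=
  fmap R1 (counit adj2 A) ∘ unit adj1 (R2 A).

Lemma right_adjoint_cmp_counit (A : D) :
  counit adj1 A ∘ fmap V' (right_adjoint_cmp A) = counit adj2 A.
Proof. exact: (transposeK adj1 (counit adj2 A)). Qed.

Lemma right_mate_change (A : D) :
  right_mate S adj2 adj A
    = right_mate S adj1 adj A ∘ fmap U' (right_adjoint_cmp A).
Proof.
have e1 := ntN (unit adj) (fmap U' (right_adjoint_cmp A)); rewrite /= in e1.
have e2 := ntN (sq_iso S) (right_adjoint_cmp A); rewrite /= in e2.
rewrite /= /right_mate_hom -[RHS]cmpA e1 !cmpA -!fmapM.
rewrite -(cmpA (fmap U _)) e2 cmpA -fmapM right_adjoint_cmp_counit.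
by rewrite fmapM.
Qed.
End MateTransfer.

(** Naturality of the unit of [adj2] reduces the composite to a triangle identity. Both adjunctions
    are quantified here, so exchanging them gives the other inverse law. *)
Lemma right_adjoint_cmpK (D' D : Category) (V' : Functor D' D)
    (R1 R2 : Functor D D') (adj1 : Adjunction V' R1) (adj2 : Adjunction V' R2)
    (A : D) :
  right_adjoint_cmp adj2 adj1 A ∘ right_adjoint_cmp adj1 adj2 A = idm _.
Proof.
rewrite /right_adjoint_cmp -cmpA.
have := ntN (unit adj2) (right_adjoint_cmp adj1 adj2 A); rewrite /= => ->.
by rewrite cmpA -fmapM right_adjoint_cmp_counit triangleR.
Qed.

Lemma right_mate_iso_transfer (D' D C' C : Category) (V' : Functor D' D)
    (U' : Functor D' C') (V : Functor C' C) (U : Functor D C)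
    (S : Square V' U' V U) (R : Functor C C') (adj : Adjunction V R)
    (R1 R2 : Functor D D') (adj1 : Adjunction V' R1) (adj2 : Adjunction V' R2) :
  IsNatIso (right_mate S adj1 adj) -> IsNatIso (right_mate S adj2 adj).
Proof.
move=> H A; rewrite (right_mate_change S adj adj1 adj2).
apply: iso_cmp; first exact: H.
by apply: (iso_fmap U'); exists (right_adjoint_cmp adj2 adj1 A);
  rewrite !right_adjoint_cmpK.
Qed.

(* Abelian group objects are handled through generalized elements [Hom Q A]. *)
Section AbElements.
Context (C : Category) (PC : HasFiniteProducts C).

Definition elt_add (A : AbObj PC) (Q : C) (x y : Hom Q (ab_ob A)) :
  Hom Q (ab_ob A) := ab_add A ∘ pair2 PC x y.

Definition elt_zero (A : AbObj PC) (Q : C) : Hom Q (ab_ob A) :=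
  ab_zero A ∘ to_terminal PC Q.

Context (A : AbObj PC).

Lemma elt_add_cmp (P Q : C) (x y : Hom Q (ab_ob A)) (w : Hom P Q) :
  elt_add x y ∘ w = elt_add (x ∘ w) (y ∘ w).
Proof. by rewrite /elt_add -cmpA pair2_cmp. Qed.

Lemma elt_zero_cmp (P Q : C) (w : Hom P Q) : elt_zero A Q ∘ w = elt_zero A P.
Proof. by rewrite /elt_zero -cmpA; congr (_ ∘ _); exact: to_terminal_uniq. Qed.

Lemma elt_add_univ :
  elt_add (fst2 PC (ab_ob A)) (snd2 PC (ab_ob A)) = ab_add A.
Proof. by rewrite /elt_add pair2_eta cmpm1. Qed.

(** The three elements form one element [w] of the ternary power, and [ab_addA] is pulled back along
    it. *)
Lemma elt_addA (Q : C) (x y z : Hom Q (ab_ob A)) :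
  elt_add (elt_add x y) z = elt_add x (elt_add y z).
Proof.
pose f (i : 'I_3) := match val i with 0 => x | 1 => y | _ => z end.
pose w := lift (productP PC (fun _ : 'I_3 => ab_ob A)) f.
have e i : proj3 PC (ab_ob A) i ∘ w = f i.
  exact: (liftE (productP PC (fun _ : 'I_3 => ab_ob A)) f i).
have := congr1 (fun h => h ∘ w) (ab_addA A); rewrite /= -!/(elt_add _ _).
by rewrite !elt_add_cmp !e.
Qed.

Lemma elt_addC (Q : C) (x y : Hom Q (ab_ob A)) : elt_add x y = elt_add y x.
Proof.
by rewrite /elt_add -{1}ab_addC -cmpA pair2_cmp fst2_pair2 snd2_pair2.
Qed.

Lemma elt_add0 (Q : C) (x : Hom Q (ab_ob A)) : elt_add (elt_zero A Q) x = x.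
Proof.
have := congr1 (fun h => h ∘ x) (ab_add0 A); rewrite /= -/(elt_zero _ _).
by rewrite -/(elt_add _ _) elt_add_cmp elt_zero_cmp cmp1m.
Qed.

Lemma elt_addN (Q : C) (x : Hom Q (ab_ob A)) :
  elt_add (ab_opp A ∘ x) x = elt_zero A Q.
Proof.
have := congr1 (fun h => h ∘ x) (ab_addN A); rewrite /= -/(elt_zero _ _).
by rewrite -/(elt_add _ _) elt_add_cmp elt_zero_cmp cmp1m.
Qed.

(** Adding the opposite of [z] cancels it. Preservation of zero and opposites by additive maps rests
    on this. *)
Lemma elt_addI (Q : C) (x y z : Hom Q (ab_ob A)) :
  elt_add x z = elt_add y z -> x = y.
Proof.
move=> e; rewrite -(elt_add0 x) -(elt_add0 y) ![elt_add (elt_zero _ _) _]elt_addC.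
by rewrite -(elt_addN z) [elt_add (_ ∘ z) z]elt_addC -!elt_addA e.
Qed.
End AbElements.

(** * Additive maps on generalized elements *)

Section AbHomElements.
Context (C : Category) (PC : HasFiniteProducts C) (A B : AbObj PC)
  (f : Hom (ab_ob A) (ab_ob B)) (Hf : IsAbHom f).

Lemma abhom_add (Q : C) (x y : Hom Q (ab_ob A)) :
  f ∘ elt_add x y = elt_add (f ∘ x) (f ∘ y).
Proof.
rewrite /elt_add cmpA Hf -cmpA pair2_cmp -!cmpA.
by rewrite fst2_pair2 snd2_pair2.
Qed.

(** The image of zero is idempotent under addition, so one summand cancels. *)
Lemma abhom_zero (Q : C) : f ∘ elt_zero A Q = elt_zero B Q.
Proof.
apply: (@elt_addI _ _ _ _ _ _ (f ∘ elt_zero A Q)).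
by rewrite -abhom_add !elt_add0.
Qed.

(** Both sides give zero when [f] is added to them. *)
Lemma abhom_opp : f ∘ ab_opp A = ab_opp B ∘ f.
Proof.
apply: (@elt_addI _ _ _ _ _ _ f); rewrite elt_addN.
have := abhom_add (ab_opp A ∘ idm _) (idm _); rewrite !cmpm1 => <-.
by have := elt_addN (idm (ab_ob A)); rewrite cmpm1 => ->; exact: abhom_zero.
Qed.
End AbHomElements.

(** * Product-preserving functors and generalized elements *)

Section AbFunctorElements.
Context (C D : Category) (PC : HasFiniteProducts C) (PD : HasFiniteProducts D)
  (F : Functor C D) (PF : PreservesFiniteProducts F).

Lemma fmap_elt_add (A : AbObj PC) (Q : C) (x y : Hom Q (ab_ob A)) :
  fmap F (elt_add x y)
    = elt_add (A := abF_ob PD PF A) (fmap F x) (fmap F y).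
Proof. by symmetry; exact: abF_add_pair2. Qed.

Lemma fmap_elt_zero (A : AbObj PC) (Q : C) :
  fmap F (elt_zero A Q) = elt_zero (abF_ob PD PF A) (F Q).
Proof. by symmetry; exact: abF_zero_terminal. Qed.

(** The addition of [abF_ob] passes through [pcomp], and composing with [pcomp] turns the images of
    the projections into the projections of the power in [D]. *)
Lemma abhom_from_abF (A : AbObj PC) (B : AbObj PD)
    (f : Hom (F (ab_ob A)) (ab_ob B)) :
  f ∘ fmap F (ab_add A)
    = elt_add (f ∘ fmap F (fst2 PC (ab_ob A))) (f ∘ fmap F (snd2 PC (ab_ob A))) ->
  IsAbHom (A := abF_ob PD PF A) f.
Proof.
move=> e; rewrite /IsAbHom /= /abF_add cmpA e elt_add_cmp -!cmpA.
by rewrite pcomp_fst pcomp_snd.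
Qed.

Lemma faithful_reflects_abhom (A B : AbObj PC) (f : Hom (ab_ob A) (ab_ob B)) :
  Faithful F ->
  IsAbHom (A := abF_ob PD PF A) (B := abF_ob PD PF B) (fmap F f) ->
  IsAbHom f.
Proof.
move=> FF Hf; apply: FF; rewrite -/(elt_add _ _) -elt_add_univ fmapM.
by rewrite !fmap_elt_add (abhom_add Hf) !fmapM.
Qed.
End AbFunctorElements.

Arguments fmap_elt_add {C D PC} PD {F} PF {A Q} x y.

Arguments fmap_elt_zero {C D PC} PD {F} PF A Q.

(** * The induced adjunction on abelian group objects *)

Section AbAdjunction.
Context (C D : Category) (PC : HasFiniteProducts C) (PD : HasFiniteProducts D)
  (L : Functor C D) (R : Functor D C) (adj : Adjunction L R)
  (PL : PreservesFiniteProducts L) (PR : PreservesFiniteProducts R).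

Let L' := ab_functor PC PD PL.
Let R' := ab_functor PD PC PR.

(** Naturality of the unit at the addition and at both projections leaves only that [R] and [L]
    preserve sums of elements. *)
Lemma ab_unitP (A : AbObj PC) :
  IsAbHom (A := A) (B := abF_ob PC PR (abF_ob PD PL A)) (unit adj (ab_ob A)).
Proof.
have e X Y (f : Hom X Y) := ntN (unit adj) f; rewrite /= in e.
rewrite /IsAbHom -/(elt_add _ _) !e -elt_add_cmp -!fmap_elt_add.
by rewrite elt_add_univ.
Qed.

Lemma ab_counitP (A : AbObj PD) :
  IsAbHom (A := abF_ob PD PL (abF_ob PC PR A)) (B := A) (counit adj (ab_ob A)).
Proof.
have e X Y (f : Hom X Y) := ntN (counit adj) f; rewrite /= in e.
apply: abhom_from_abF; rewrite /= /abF_add -(pcomp_fst PD PC PR).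
rewrite -(pcomp_snd PD PC PR) !fmapM !cmpA !e -!cmpA -elt_add_cmp.
by rewrite elt_add_univ.
Qed.

Definition ab_unit_hom (A : Ab PC) : @Hom (Ab PC) A (R' (L' A)) :=
  exist _ (unit adj (ab_ob A)) (ab_unitP A).

Definition ab_counit_hom (A : Ab PD) : @Hom (Ab PD) (L' (R' A)) A :=
  exist _ (counit adj (ab_ob A)) (ab_counitP A).

Lemma ab_unitN (A B : Ab PC) (f : Hom A B) :
  ab_unit_hom B ∘ f = fmap (R' ∙ L') f ∘ ab_unit_hom A.
Proof. by apply: sig_eq; exact: (ntN (unit adj) (proj1_sig f)). Qed.

Lemma ab_counitN (A B : Ab PD) (f : Hom A B) :
  ab_counit_hom B ∘ fmap (L' ∙ R') f = f ∘ ab_counit_hom A.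
Proof. by apply: sig_eq; exact: (ntN (counit adj) (proj1_sig f)). Qed.

Lemma ab_triangleL (A : Ab PC) :
  ab_counit_hom (L' A) ∘ fmap L' (ab_unit_hom A) = idm (L' A).
Proof. by apply: sig_eq; exact: triangleL. Qed.

Lemma ab_triangleR (A : Ab PD) :
  fmap R' (ab_counit_hom A) ∘ ab_unit_hom (R' A) = idm (R' A).
Proof. by apply: sig_eq; exact: triangleR. Qed.

Definition ab_adj : Adjunction L' R' :=
  {| unit := @Build_NatTrans _ _ (fid (Ab PC)) (R' ∙ L') ab_unit_hom ab_unitN;
     counit :=
       @Build_NatTrans _ _ (L' ∙ R') (fid (Ab PD)) ab_counit_hom ab_counitN;
     triangleL := ab_triangleL; triangleR := ab_triangleR |}.
End AbAdjunction.

(** * Lifting group structures along a faithful functor *)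

Section LiftAb.
Context (C D : Category) (PC : HasFiniteProducts C) (PD : HasFiniteProducts D)
  (F : Functor C D) (PF : PreservesFiniteProducts F) (FF : Faithful F)
  (X : C) (A : AbObj PD) (i : Hom (F X) (ab_ob A)) (Hi : IsIso i)
  (m : Hom (power PC bool X) X) (z : Hom (terminal PC) X) (o : Hom X X)
  (Hm : i ∘ fmap F m
     = elt_add (i ∘ fmap F (fst2 PC X)) (i ∘ fmap F (snd2 PC X)))
  (Hz : i ∘ fmap F z = elt_zero A _) (Ho : i ∘ fmap F o = ab_opp A ∘ i).

(** This lets every group axiom on [X] be tested on elements of [A], where it is known. *)
Lemma lift_ab_inj (Q : C) (x y : Hom Q X) :
  i ∘ fmap F x = i ∘ fmap F y -> x = y.
Proof.
have [j [ji _]] := Hi => e; apply: FF.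
by rewrite -(cmp1m (fmap F x)) -ji -cmpA e cmpA ji cmp1m.
Qed.

Lemma lift_ab_add (Q : C) (x y : Hom Q X) :
  i ∘ fmap F (m ∘ pair2 PC x y) = elt_add (i ∘ fmap F x) (i ∘ fmap F y).
Proof.
by rewrite fmapM cmpA Hm elt_add_cmp -!cmpA -!fmapM fst2_pair2 snd2_pair2.
Qed.

Lemma lift_ab_zero (Q : C) :
  i ∘ fmap F (z ∘ to_terminal PC Q) = elt_zero A (F Q).
Proof. by rewrite fmapM cmpA Hz elt_zero_cmp. Qed.

Lemma lift_ab_addA :
  let p i := proj3 PC X i in
  let p0 := p (@Ordinal 3 0 isT) in
  let p1 := p (@Ordinal 3 1 isT) in
  let p2 := p (@Ordinal 3 2 isT) in
  m ∘ pair2 PC (m ∘ pair2 PC p0 p1) p2 = m ∘ pair2 PC p0 (m ∘ pair2 PC p1 p2).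
Proof. by move=> *; apply: lift_ab_inj; rewrite !lift_ab_add elt_addA. Qed.

Lemma lift_ab_addC : m ∘ pair2 PC (snd2 PC X) (fst2 PC X) = m.
Proof. by apply: lift_ab_inj; rewrite lift_ab_add elt_addC Hm. Qed.

Lemma lift_ab_add0 : m ∘ pair2 PC (z ∘ to_terminal PC X) (idm X) = idm X.
Proof.
by apply: lift_ab_inj; rewrite lift_ab_add lift_ab_zero elt_add0.
Qed.

Lemma lift_ab_addN : m ∘ pair2 PC o (idm X) = z ∘ to_terminal PC X.
Proof.
apply: lift_ab_inj; rewrite lift_ab_add lift_ab_zero Ho fmap1 cmpm1.
by rewrite elt_addN.
Qed.

Definition lift_ab : AbObj PC :=
  {| ab_ob := X; ab_add := m; ab_zero := z; ab_opp := o;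
     ab_addA := lift_ab_addA; ab_addC := lift_ab_addC;
     ab_add0 := lift_ab_add0; ab_addN := lift_ab_addN |}.

Lemma lift_abP : IsAbHom (A := abF_ob PD PF lift_ab) (B := A) i.
Proof. exact: abhom_from_abF. Qed.
End LiftAb.

Lemma abhom_inverse (C : Category) (PC : HasFiniteProducts C) (A B : Ab PC)
    (f : Hom A B) : IsIso (proj1_sig f) -> IsIso f.
Proof.
case: f => f Hf [g [/= gf fg]].
have Hg : IsAbHom (A := B) (B := A) g.
  rewrite /IsAbHom -/(elt_add _ _) -(cmp1m (elt_add _ _)) -gf -cmpA.
  rewrite (abhom_add Hf) !cmpA fg !cmp1m.
  by rewrite -cmpA pair2_eta cmpm1.
exists (exist _ g Hg : @Hom (Ab PC) B A); split; exact: sig_eq.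
Qed.

(** * Coalgebras and creation of products *)

Section Coalgebras.
Context (C : Category) (G : Comonad C).

Lemma coalg_forget_faithful : Faithful (coalg_forget G).
Proof. by move=> X Y f g; exact: sig_eq. Qed.

Lemma coalg_iso_inverse (A B : CoAlg G) (f : Hom A B) :
  IsIso (proj1_sig f) -> IsIso f.
Proof.
case: f => f Hf [g [/= gf fg]].
have Hg : co_act A ∘ g = fmap G g ∘ co_act B.
  rewrite -[RHS]cmpm1 -fg cmpA -(cmpA (fmap G g)) Hf.
  by rewrite !cmpA -fmapM gf fmap1 cmp1m.
by exists (exist _ g Hg : @Hom (CoAlg G) B A); split; apply: sig_eq.
Qed.

Lemma coalg_cone_uniq (I : Type) (X : I -> CoAlg G) (a b : Cone X) :
  IsProduct (map_cone G (map_cone (coalg_forget G) a)) ->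
  map_cone (coalg_forget G) a = map_cone (coalg_forget G) b -> a = b.
Proof.
case: a b => [[x s e d] p] [[y t e' d'] q] HG E.
have h : x = y by case: E.
subst y; have {}E i : proj1_sig (p i) = proj1_sig (q i).
  (* The type of the projections depends on the apex, so their equality has to be extracted from a
     dependent pair. *)
  case: E => E; have := EqdepTheory.inj_pair2 _ _ _ _ _ E.
  by move=> /(congr1 (fun f => f i)).
(* Both coactions make the same maps into coalgebra maps, and the [G (p i)] are jointly monic. *)
have st : s = t.
  apply: (product_uniq HG) => i /=.
  by rewrite -(proj2_sig (p i)) E (proj2_sig (q i)).
subst t; rewrite (proof_irrelevance _ e' e) (proof_irrelevance _ d' d) in q E *.
congr Build_Cone; apply: functional_extensionality_dep => i; exact: sig_eq.
Qed.

(** The coaction [s] is the only map for which all projections are coalgebra maps. *)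
Lemma coalg_creates (PG : PreservesFiniteProducts G) :
  CreatesFiniteProducts (coalg_forget G).
Proof.
move=> I X [P p] Hc.
(* The counit law is tested on the projections of [P], and coassociativity on those of [G (G P)]. *)
have HG := PG _ _ _ Hc; have HGG := PG _ _ _ HG.
pose s : Hom P (G P) := lift HG (fun i => co_act (X i) ∘ p i).
have Hs i : fmap G (p i) ∘ s = co_act (X i) ∘ p i.
  exact: (liftE HG (fun i => co_act (X i) ∘ p i)).
have s_eps : eps G P ∘ s = idm P.
  apply: (product_uniq Hc) => i /=.
  have := ntN (eps G) (p i); rewrite /= cmpA => <-.
  by rewrite -cmpA Hs cmpA co_eps cmp1m cmpm1.
have s_delta : delta G P ∘ s = fmap G s ∘ s.
  apply: (product_uniq HGG) => i /=.
  have := ntN (delta G) (p i); rewrite /= !cmpA => <-.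
  rewrite -fmapM Hs -cmpA Hs fmapM -(cmpA (fmap G _)) Hs.
  by rewrite !cmpA co_delta.
pose A : CoAlg G := Build_CoAlgObj s_eps s_delta.
pose c' : Cone X :=
  {| apex := A;
     proj := fun i => exist _ (p i) (esym (Hs i)) : @Hom (CoAlg G) A (X i) |}.
exists c'; split=> [|c'' Hc''|].
- by [].
- by apply: coalg_cone_uniq; rewrite Hc''.
move=> Q f; have [h [Hh hu]] := Hc Q (fun i => proj1_sig (f i)).
have Hco : s ∘ h = fmap G h ∘ co_act Q.
  apply: (product_uniq HG) => i.
  rewrite /= !cmpA Hs -fmapM -cmpA; rewrite /= in Hh.
  by rewrite Hh (proj2_sig (f i)).
exists (exist _ h Hco : @Hom (CoAlg G) Q c'); split=> [i|k Hk].
  by apply: sig_eq; exact: Hh.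
by apply: sig_eq; apply: hu => i; rewrite -Hk.
Qed.
End Coalgebras.

(** * Abelian group objects in coalgebras *)

Section AbCoalgebras.
Context (C : Category) (PC : HasFiniteProducts C) (G : Comonad C)
  (cr : CreatesFiniteProducts (coalg_forget G)).

Let V := coalg_forget G.
Let PCo : HasFiniteProducts (CoAlg G) := creates_has cr PC.
Let PV : PreservesFiniteProducts V := creates_preserves cr PC.
Let PR := right_adjoint_preserves (cofree_adj G).
Let U := ab_forget PC.
Let U' := ab_forget PCo.
Let V' := ab_created PC cr.
Let S := ab_square PC cr.

Definition ab_cofree_adj : Adjunction V' (ab_functor PC PCo PR) :=
  ab_adj PCo PC (cofree_adj G) PV PR.

Let M := adj_comonad ab_cofree_adj.

(** On carriers [M] is [G], but its group structure is transported first along the cofree functor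
    and then along [V]; each transport preserves sums. *)
Lemma fmap_comonad_elt_add (A : Ab PC) (Q : C) (x y : Hom Q (ab_ob A)) :
  fmap G (elt_add x y)
    = elt_add (A := (M A : Ab PC)) (fmap G x) (fmap G y).
Proof.
have := congr1 (@proj1_sig _ _) (fmap_elt_add PCo PR x y) => /= e.
have := fmap_elt_add PC PV (A := abF_ob PCo PR A)
  (fmap (cofree G) x) (fmap (cofree G) y) => /= <-.
exact: e.
Qed.

Lemma fmap_comonad_elt_zero (A : Ab PC) (Q : C) :
  fmap G (elt_zero A Q) = elt_zero (M A : Ab PC) (G Q).
Proof.
have := congr1 (@proj1_sig _ _) (fmap_elt_zero PCo PR A Q) => /= e.
have := fmap_elt_zero PC PV (abF_ob PCo PR A) (cofree G Q) => /= <-.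
exact: e.
Qed.

(** * From [M]-coalgebras to group objects in coalgebras *)

Section LiftCoalgebra.
Context (Z : CoAlg M).

Let A : Ab PC := co_ob Z.
Let s : Hom (ab_ob A) (G (ab_ob A)) := proj1_sig (co_act Z).
Let Hs : IsAbHom (A := A) (B := (M A : Ab PC)) s := proj2_sig (co_act Z).

Definition underlying_coalg : CoAlg G :=
  @Build_CoAlgObj C G (ab_ob A) s (congr1 (@proj1_sig _ _) (co_eps Z))
    (congr1 (@proj1_sig _ _) (co_delta Z)).

Let X := underlying_coalg.

(** Since [s] is additive, sums of coalgebra maps are coalgebra maps; the sum of the two projections
    yields [coalg_add]. *)
Lemma coalg_elt_addP (Y : CoAlg G) (x y : @Hom (CoAlg G) Y X) :
  s ∘ elt_add (A := A) (proj1_sig x) (proj1_sig y)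
    = fmap G (elt_add (A := A) (proj1_sig x) (proj1_sig y)) ∘ co_act Y.
Proof.
rewrite (abhom_add Hs) fmap_comonad_elt_add (elt_add_cmp (A := (M A : Ab PC))).
exact: (f_equal2 (@elt_add _ PC (M A) _) (proj2_sig x) (proj2_sig y)).
Qed.

Lemma coalg_elt_zeroP (Y : CoAlg G) :
  s ∘ elt_zero A (co_ob Y) = fmap G (elt_zero A (co_ob Y)) ∘ co_act Y.
Proof.
rewrite (abhom_zero Hs) fmap_comonad_elt_zero.
by rewrite (elt_zero_cmp (M A : Ab PC)).
Qed.

Lemma coalg_oppP : s ∘ ab_opp A = fmap G (ab_opp A) ∘ s.
Proof. by rewrite (abhom_opp Hs). Qed.

Definition coalg_add : Hom (power PCo bool X) X :=
  exist _ _ (coalg_elt_addP (fst2 PCo X) (snd2 PCo X)).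

Definition coalg_zero : Hom (terminal PCo) X :=
  exist _ _ (coalg_elt_zeroP (terminal PCo)).

Definition coalg_opp : Hom X X := exist _ (ab_opp A) coalg_oppP.

Let i : Hom (V X) (ab_ob A) := idm (ab_ob A).
Let Hi : IsIso i := iso_idm (ab_ob A).

Lemma coalg_addE :
  i ∘ fmap V coalg_add
    = elt_add (i ∘ fmap V (fst2 PCo X)) (i ∘ fmap V (snd2 PCo X)).
Proof. by rewrite !cmp1m. Qed.

Lemma coalg_zeroE : i ∘ fmap V coalg_zero = elt_zero A _.
Proof. by rewrite cmp1m. Qed.

Lemma coalg_oppE : i ∘ fmap V coalg_opp = ab_opp A ∘ i.
Proof. by rewrite cmp1m cmpm1. Qed.

Definition lift_coalg : Ab PCo :=
  lift_ab (@coalg_forget_faithful C G) Hi coalg_addE coalg_zeroE coalg_oppE.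

(** The identity on carriers. The addition of [V' lift_coalg] still passes through [pcomp], so an
    isomorphism is used instead of an equality of objects. *)
Definition lift_coalg_hom : @Hom (Ab PC) (V' lift_coalg) A :=
  exist _ i (lift_abP PV (@coalg_forget_faithful C G) Hi
    coalg_addE coalg_zeroE coalg_oppE).

Lemma lift_coalg_iso : IsIso lift_coalg_hom.
Proof. by apply: abhom_inverse; exact: iso_idm. Qed.
End LiftCoalgebra.

(** Compatibility with the coactions gives a coalgebra map, whose additivity is reflected by the
    faithful functor [V]. Fullness of both comparison functors below comes from this. *)
Lemma ab_created_lift (A B : Ab PCo) (f : Hom (V' A) (V' B)) :
  co_act (ab_ob B) ∘ proj1_sig f = fmap G (proj1_sig f) ∘ co_act (ab_ob A) ->
  exists g : Hom A B, fmap V' g = f.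
Proof.
move=> Hf.
pose h : Hom (ab_ob A) (ab_ob B) := exist _ (proj1_sig f) Hf.
have Hh : IsAbHom (A := A) (B := B) h.
  exact: (@faithful_reflects_abhom _ _ PCo PC V PV A B h
    (@coalg_forget_faithful C G) (proj2_sig f)).
by exists (exist _ h Hh : @Hom (Ab PCo) A B); exact: sig_eq.
Qed.

Lemma ab_created_faithful : Faithful V'.
Proof.
move=> A B f g /(congr1 (@proj1_sig _ _)) e.
by apply: sig_eq; exact: sig_eq.
Qed.

Lemma ab_created_comonadic : Comonadic V'.
Proof.
exists (ab_functor PC PCo PR), ab_cofree_adj.
apply: equivalence_of_ff_es => [A B f|Z].
  have [g Hg] := ab_created_lift (congr1 (@proj1_sig _ _) (proj2_sig f)).
  exists g; split=> [|k Hk]; first exact: sig_eq.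
  by apply: ab_created_faithful; rewrite Hg -Hk.
have Hf : co_act Z ∘ lift_coalg_hom Z
    = fmap M (lift_coalg_hom Z)
        ∘ co_act (comparison_ob ab_cofree_adj (lift_coalg Z)).
  by apply: sig_eq; rewrite /= fmap1 cmpm1 cmp1m.
exists (lift_coalg Z).
exists (exist _ (lift_coalg_hom Z) Hf :
  @Hom (CoAlg M) (comparison ab_cofree_adj (lift_coalg Z)) Z).
by apply: coalg_iso_inverse; exact: lift_coalg_iso.
Qed.

Lemma ab_square_cartesian : FullyFaithful U -> IsCartesian S.
Proof.
move=> UFF.
apply: equivalence_of_ff_es => [A B f|[X B phi [psi [psiphi phipsi]]]].
  (* The square commutes by identities, so the two components of [f] have the same underlying
     map. *)
  have e : proj1_sig (proj1_sig f).2 = proj1_sig (proj1_sig f).1.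
    by have := proj2_sig f; rewrite /= cmp1m cmpm1.
  have [|g Hg] := @ab_created_lift A B (proj1_sig f).2.
    by rewrite e; exact: (proj2_sig (proj1_sig f).1).
  exists g; split=> [|k Hk].
    apply: sig_eq; rewrite /= [LHS]surjective_pairing /=.
    rewrite [RHS]surjective_pairing -Hg; congr pair.
    by apply: sig_eq; rewrite -e -Hg.
  by apply: ab_created_faithful; rewrite Hg -Hk.
(* The coaction of [X] is transported to the carrier of [B] along [phi]; fullness of [U] makes it
   additive. *)
have [s [Hs _]] := UFF B (M B) (fmap G phi ∘ co_act X ∘ psi).
rewrite /= in Hs.
have s_eps : counit ab_cofree_adj B ∘ s = idm B.
  apply: sig_eq; rewrite /= Hs !cmpA.
  have := ntN (eps G) phi; rewrite /= => ->.
  by rewrite -(cmpA phi) co_eps cmpm1.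
have s_delta : delta M B ∘ s = fmap M s ∘ s.
  apply: sig_eq; rewrite /= Hs !fmapM !cmpA.
  have := ntN (delta G) phi; rewrite /= => ->.
  rewrite -(cmpA (fmap G (fmap G phi))) co_delta !cmpA.
  by rewrite -(cmpA _ (fmap G psi)) -(fmapM _ psi) psiphi fmap1 cmpm1.
pose Z : CoAlg M := @Build_CoAlgObj _ M B s s_eps s_delta.
have Hpsi : co_act X ∘ psi = fmap G psi ∘ proj1_sig s.
  by rewrite Hs !cmpA -fmapM psiphi fmap1 cmp1m.
pose h : @Hom (CoAlg G) (underlying_coalg Z) X := exist _ psi Hpsi.
exists (lift_coalg Z).
have Hh : fmap U (lift_coalg_hom Z) ∘ idm _ = phi ∘ fmap V h.
  by rewrite /= phipsi cmpm1.
exists (exist _ (h, lift_coalg_hom Z) Hh).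
(* The first component is [psi], with inverse [phi]; the second is the identity on carriers. *)
apply: pullback_iso; last exact: lift_coalg_iso.
by apply: coalg_iso_inverse; exists phi.
Qed.

(** For [ab_cofree_adj] the mate is [G] of the counit after [delta], an identity by a comonad law;
    any other right adjoint is compared with this one. *)
Lemma ab_square_right_mate (G' : Functor (Ab PC) (Ab PCo))
  (adj' : Adjunction V' G') : IsNatIso (right_mate S adj' (cofree_adj G)).
Proof.
apply: (right_mate_iso_transfer (adj1 := ab_cofree_adj)) => A.
have -> : right_mate S ab_cofree_adj (cofree_adj G) A
    = idm (cofree G (ab_ob A)); last exact: iso_idm.
by apply: sig_eq; rewrite /= fmap1 cmpm1; exact: comonad_epsr.
Qed.

(** * Lifting the free abelian group functor *)

Section LeftAdjoint.
Context (D : Functor C (Ab PC)) (adj : Adjunction D U).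

Section FreeCoalgebra.
Context (X : CoAlg G).

Let A : Ab PC := D (V X).
Let eta : Hom (V X) (ab_ob A) := unit adj (V X).

Definition free_act : Hom A (M A) :=
  transpose adj (Y := M A) (fmap G eta ∘ co_act X).

(** This makes [eta] a coalgebra map. It also reduces the coalgebra laws of [free_act] to those of
    [X], since additive maps out of [A] are determined by their composite with [eta]. *)
Lemma free_actE : proj1_sig free_act ∘ eta = fmap G eta ∘ co_act X.
Proof. exact: (transposeE adj (Y := M A)). Qed.

Lemma free_act_eps : counit ab_cofree_adj A ∘ free_act = idm A.
Proof.
apply: (transpose_inj (adj := adj)).
rewrite -[LHS]/(eps G _ ∘ proj1_sig free_act ∘ eta) -cmpA free_actE cmpA fmap1.
have := ntN (eps G) eta; rewrite /= => ->.
by rewrite -cmpA co_eps cmpm1 cmp1m.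
Qed.

Lemma free_act_delta : delta M A ∘ free_act = fmap M free_act ∘ free_act.
Proof.
apply: (transpose_inj (adj := adj)).
rewrite -[LHS]/(delta G _ ∘ proj1_sig free_act ∘ eta).
rewrite -[RHS]/(fmap G (proj1_sig free_act) ∘ proj1_sig free_act ∘ eta).
rewrite -[LHS]cmpA -[RHS]cmpA free_actE !cmpA.
have := ntN (delta G) eta; rewrite /= => ->.
by rewrite -fmapM free_actE fmapM -!cmpA co_delta.
Qed.

Definition free_coalg : CoAlg M :=
  @Build_CoAlgObj _ M A free_act free_act_eps free_act_delta.

Definition free_unit : Hom X (U' (lift_coalg free_coalg)) :=
  exist _ eta free_actE.

(** The underlying map of [f] extends uniquely to an additive map [t]. It respects the coactions
    because both composites agree on [eta], so it lifts. *)
Lemma free_universal (B : Ab PCo) (f : Hom X (U' B)) :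
  exists! g : Hom (lift_coalg free_coalg) B, fmap U' g ∘ free_unit = f.
Proof.
pose t : Hom A (V' B) := transpose adj (Y := V' B) (proj1_sig f).
have Ht : proj1_sig t ∘ eta = proj1_sig f.
  exact: (transposeE adj (Y := V' B)).
have t_act : fmap V' (unit ab_cofree_adj B) ∘ t = fmap M t ∘ free_act.
  apply: (transpose_inj (adj := adj)).
  rewrite -[LHS]/(co_act (ab_ob B) ∘ proj1_sig t ∘ eta).
  rewrite -[RHS]/(fmap G (proj1_sig t) ∘ proj1_sig free_act ∘ eta).
  rewrite -[LHS]cmpA -[RHS]cmpA free_actE Ht cmpA -fmapM Ht; exact: (proj2_sig f).
have [|g Hg] := @ab_created_lift (lift_coalg free_coalg) B
    (t ∘ lift_coalg_hom free_coalg).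
  by rewrite /= cmpm1; exact: (congr1 (@proj1_sig _ _) t_act).
have {}Hg : proj1_sig (proj1_sig g) = proj1_sig t.
  by have := congr1 (@proj1_sig _ _) Hg; rewrite /= cmpm1.
exists g; split=> [|k Hk]; first by apply: sig_eq; rewrite /= Hg.
have [j [ij _]] := lift_coalg_iso free_coalg.
have {}ij : proj1_sig j = idm (ab_ob A).
  by have := congr1 (@proj1_sig _ _) ij; rewrite /= cmpm1.
(* Composing with [j] turns [k] into a map out of [A], where the universal property of [D]
   applies. *)
have e : fmap V' k ∘ j = t.
  apply: (transpose_inj (adj := adj)).
  rewrite -[LHS]/(proj1_sig (proj1_sig k) ∘ proj1_sig j ∘ eta) ij cmpm1 [RHS]Ht.
  exact: (congr1 (@proj1_sig _ _) Hk).
by apply: sig_eq; apply: sig_eq; rewrite Hg -e /= ij cmpm1.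
Qed.
End FreeCoalgebra.

(** The mate is the extension of [eta] along itself, hence an identity up to the comparison
    [lift_coalg_hom]. *)
Lemma ab_square_distributive :
  exists (D' : Functor (CoAlg G) (Ab PCo)) (adj' : Adjunction D' U'),
    IsDistributive S adj' adj.
Proof.
exists (univ_functor free_universal), (univ_adj free_universal) => X.
have [j [ij ji]] := lift_coalg_iso (free_coalg X).
set mate := left_mate _ _ _ _.
pose B := V' (lift_coalg (free_coalg X)).
have mateE : mate = transpose adj (Y := B) (unit adj (V X)).
  rewrite -[mate]/(counit adj B ∘ fmap D (idm (U B)) ∘ fmap D (unit adj (V X))).
  by rewrite fmap1 cmpm1.
have e : lift_coalg_hom (free_coalg X) ∘ mate = idm (D (V X)).
  apply: (transpose_inj (adj := adj)); rewrite fmapM fmap1 !cmp1m mateE.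
  exact: (transposeE adj (Y := B)).
(* A right inverse of the isomorphism [lift_coalg_hom] is its inverse [j]. *)
have -> : mate = j by rewrite -(cmp1m mate) -ij -cmpA e cmpm1.
by exists (lift_coalg_hom (free_coalg X)).
Qed.
End LeftAdjoint.
End AbCoalgebras.

Theorem proposition2p9p2 (C : Category) (PC : HasFiniteProducts C)
    (G : Comonad C) (PG : PreservesFiniteProducts G) :
  exists cr : CreatesFiniteProducts (coalg_forget G),
    let U := ab_forget PC in
    let U' := ab_forget (creates_has cr PC) in
    let V' := ab_created PC cr in
    let S := ab_square PC cr in
    Comonadic V' /\
    (FullyFaithful U -> IsCartesian S) /\
    (forall (G' : Functor (Ab PC) (Ab (creates_has cr PC)))
            (adj' : Adjunction V' G'),
       IsNatIso (right_mate S adj' (cofree_adj G))) /\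
    (forall (D : Functor C (Ab PC)) (adj : Adjunction D U),
       exists (D' : Functor (CoAlg G) (Ab (creates_has cr PC)))
              (adj' : Adjunction D' U'),
         IsDistributive S adj' adj).
Proof.
exists (coalg_creates PG); split; first exact: ab_created_comonadic.
split; first exact: ab_square_cartesian.
split; first exact: ab_square_right_mate.
exact: ab_square_distributive.
Qed.
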